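(* A B-series integrator map $\phi=\sum_{\tau\in T}\frac{b(\tau)}{\sigma(\tau)}\tau$ is quadratic functionally equivariant if and only if its coefficients satisfy $b(u\circ v)+b(v\circ u)=0$ for all $u,v\in T$.
   Context: All spaces are real Banach spaces; $\mathfrak{X}(Y)$ denotes smooth vector fields on $Y$. An integrator map $\phi$ is a collection of smooth maps $\phi_Y\colon\mathfrak X(Y)\to\mathfrak X(Y)$, one per Banach space $Y$. $T$ is the set of rooted trees; write $\tau=[\tau_1,\ldots,\tau_m]$ for the tree whose root has children that are the roots of subtrees $\tau_1,\ldots,\tau_m$, and $\bullet$ for the one-vertex tree. Each tree defines the elementary differential $\tau(f)$: $\bullet(f)=f$ and $[\tau_1,\ldots,\tau_m](f)=f^{(m)}\bigl(\tau_1(f),\ldots,\tau_m(f)\bigr)$, where $f^{(m)}$ is the $m$-th derivative. The symmetry coefficient is $\sigma(\bullet)=1$ and $\sigma(\tau)=\sigma(\tau_1)\cdots\sigma(\tau_m)\mu_1!\cdots\mu_k!$, where $\mu_1,\ldots,\mu_k$ count the occurrences of each distinct tree among $\tau_1,\ldots,\tau_m$. The Butcher product $u\circ v$ is the tree obtained by attaching the root of $v$ as an additional child of the root of $u$ (e.g. $\bullet\circ[\bullet]=[[\bullet]]$, $[\bullet]\circ\bullet=[\bullet,\bullet]$). A B-series integrator map is an integrator map of the form $\phi(f)=\sum_{\tau\in T}\frac{b(\tau)}{\sigma(\tau)}\tau(f)$ with real coefficients $b(\tau)$. A map $F\colon Y\to Z$ is quadratic if $F'''=0$. Given $F$ and $f\in\mathfrak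 X(Y)$, the augmented vector field is $g(y,z)=(f(y),F'(y)f(y))$ on $Y\times Z$; $\phi$ is $F$-functionally equivariant if $\phi(f)\sim_{(\mathrm{id},F)}\phi(g)$ for all $f$, where $f\sim_\chi g$ means $\chi'(y)f(y)=g(\chi(y))$ for all $y$ and $(\mathrm{id},F)(y)=(y,F(y))$. $\phi$ is quadratic functionally equivariant if it is $F$-functionally equivariant for every quadratic $F\colon Y\to Z$ and all Banach spaces $Y,Z$. *)

(* Defs.v *)
From HB Require Import structures.
From mathcomp Require Import all_boot all_order all_algebra.
From mathcomp Require Import all_classical all_reals all_analysis.
Set Implicit Arguments. Unset Strict Implicit. Unset Printing Implicit Defensive.
Import Order.TTheory GRing.Theory Num.Theory.
Import numFieldNormedType.Exports.
Local Open Scope ring_scope.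

(* Plane (ordered) rooted trees; unordered rooted trees (the set T) are
   represented by their canonical plane representatives (see [canonical]). *)
Inductive tree : Type := Node of seq tree.

Definition leaf : tree := Node [::].

Fixpoint tree_order (t : tree) : nat :=
  let: Node ts := t in (sumn (map tree_order ts)).+1.

(** injective encoding of a plane tree (preorder, arities) *)
Fixpoint enc (t : tree) : seq nat :=
  let: Node ts := t in size ts :: flatten (map enc ts).

Fixpoint lexle (s t : seq nat) : bool :=
  match s, t with
  | [::], _ => true
  | _ :: _, [::] => false
  | a :: s', b :: t' => (a < b)%N || ((a == b) && lexle s' t')
  end.

Definition tle (a b : tree) : bool := lexle (enc a) (enc b).

Fixpoint canon (t : tree) : tree :=
  let: Node ts := t in Node (sort tle (map canon ts)).

Fixpoint canonicalb (t : tree) : bool :=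
  let: Node ts := t in sorted tle ts && all canonicalb ts.

Definition canonical_tree (t : tree) : Prop := canonicalb t.

Fixpoint ptrees (fuel n : nat) {struct fuel} : seq tree :=
  match fuel with
  | 0 => [::]
  | S f => match n with 0 => [::] | S k => map Node (pforests f k) end
  end
with pforests (fuel n : nat) {struct fuel} : seq (seq tree) :=
  match fuel with
  | 0 => [::]
  | S f => match n with
           | 0 => [:: [::]]
           | _ => flatten [seq [seq t :: ts | t <- ptrees f i, ts <- pforests f (n - i)]
                          | i <- iota 1 n]
           end
  end.

(** the (unordered) rooted trees of order n, each exactly once *)
Definition trees_of_order (n : nat) : seq tree :=
  [seq t <- ptrees (2 * n + 2) n | canonicalb t].

Fixpoint sigma (t : tree) : nat :=
  let: Node ts := t in
  (\prod_(k <- map sigma ts) k) *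
  \prod_(e <- undup (map (fun s => enc (canon s)) ts))
     (count (fun s => enc (canon s) == e) ts)`!.

Definition bprod (u v : tree) : tree :=
  let: Node us := u in canon (Node (v :: us)).

Section Calculus.
Variable R : realType.

(** iterated directional derivative: [Dn F [:: v1; ...; vm] x = F^{(m)}(x)(v1,...,vm)] *)
Fixpoint Dn (V W : normedModType R) (F : V -> W) (vs : seq V) : V -> W :=
  match vs with
  | [::] => F
  | v :: vs' => fun x => derive (Dn F vs') x v
  end.

(** C^k via iterated tangent maps  T F (x,v) = (F x, F'(x) v)  (Fréchet
    differentiability at every step); C^infinity = all k. *)
Fixpoint smoothN (n : nat) (V W : normedModType R) (F : V -> W) : Prop :=
  match n with
  | 0 => continuous F
  | S k => (forall x, differentiable F x) /\
           smoothN k (fun p : V * V => let: (x, v) := p in (F x, 'd F x v))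
  end.

Definition smooth (V W : normedModType R) (F : V -> W) : Prop :=
  forall n, smoothN n F.

Definition quadratic (V W : normedModType R) (F : V -> W) : Prop :=
  smooth F /\ forall x u v w, Dn F [:: u; v; w] x = 0.

Fixpoint elem (V : normedModType R) (f : V -> V) (t : tree) (x : V) : V :=
  let: Node ts := t in Dn f (map (fun s => elem f s x) ts) x.

(** homogeneous part of order n of the B-series
    phi(f) = sum_tau b(tau)/sigma(tau) tau(f) *)
Definition bseries_order (b : tree -> R) (n : nat) (V : normedModType R)
    (f : V -> V) (x : V) : V :=
  \sum_(t <- trees_of_order n) (b t / (sigma t)%:R) *: elem f t x.

Definition related (V W : normedModType R) (chi : V -> W) (f : V -> V)
    (g : W -> W) : Prop :=
  forall y, derive chi y (f y) = g (chi y).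

(** the B-series with coefficients b is F-functionally equivariant
    (as a formal series, i.e. order by order) *)
Definition F_equivariant (b : tree -> R) (Y Z : completeNormedModType R)
    (F : Y -> Z) : Prop :=
  forall f : Y -> Y, smooth f ->
    let g := fun p : Y * Z => (f p.1, derive F p.1 (f p.1)) in
    forall n : nat,
      related (fun y : Y => (y, F y)) (bseries_order b n f)
              (bseries_order b n g).

Definition quadratic_functionally_equivariant (b : tree -> R) : Prop :=
  forall (Y Z : completeNormedModType R) (F : Y -> Z),
    quadratic F -> F_equivariant b F.

End Calculus.

(* Main.v *)
Require Import Defs.
From HB Require Import structures.
From mathcomp Require Import all_boot all_order all_algebra.
From mathcomp Require Import all_classical all_reals all_analysis.
From mathcomp Require Import zify ring.
Import Order.TTheory GRing.Theory Num.Theory.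
Import numFieldNormedType.Exports.
Set Implicit Arguments. Unset Strict Implicit. Unset Printing Implicit Defensive.
Local Open Scope classical_set_scope.
Local Open Scope ring_scope.

(** A quadratic F satisfies F'(y) w = F'(0) w + B(y, w) with B symmetric and
    bilinear, so the Leibniz rule gives, for the augmented field g and
    t = [t_1, ..., t_m], that the Z-component of t(g) at (y, F y) is
    F'(y) t(f) + sum_i B(t_i(f), [.. without t_i ..](f)).  Summing over trees and
    absorbing multiplicities in the symmetry coefficients, equivariance at order n
    becomes
      sum_{|u| + |v| = n} b(u o v) / (sigma(u) sigma(v)) B(v(f), u(f)) = 0,
    which holds when b(u o v) is antisymmetric because B is symmetric.  Conversely,
    on the space with one coordinate y_s per tree s of order < n, the field with
    components f_s(y) = prod_{c child of s} y_c has t(f)(0) equal to a positive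
    multiple of the t-th basis vector, and F(y) = y_u y_v isolates the coefficient
    b(u o v) + b(v o u). *)

(** * Plane trees and their canonical representatives *)

(** The nested type [tree] needs a companion predicate [Q] on lists of subtrees to carry the
    induction hypothesis through the children. *)
Lemma tree_list_ind (P : tree -> Prop) (Q : seq tree -> Prop) :
  (forall ts, Q ts -> P (Node ts)) -> Q [::] ->
  (forall t ts, P t -> Q ts -> Q (t :: ts)) -> forall t, P t.
Proof.
move=> hN h0 hS; fix IH 1; case=> ts; apply: hN.
by elim: ts => [//|t ts IHts]; apply: hS; [exact: IH | exact: IHts].
Qed.

Definition children (t : tree) : seq tree := let: Node ts := t in ts.

(** The leading arity says how many subtrees to read, so the encoding is self-delimiting. The
    suffixes let the induction pass through concatenation. *)
Lemma enc_prefix_code t t' s s' : enc t ++ s = enc t' ++ s' -> t = t' /\ s = s'.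
Proof.
move: t t' s s'; apply: (@tree_list_ind _ (fun ts => forall ts' s s',
  size ts = size ts' ->
  flatten (map enc ts) ++ s = flatten (map enc ts') ++ s' -> ts = ts' /\ s = s')).
- move=> ts IH [ts'] s s' /= [hs].
  by move=> /(IH _ _ _ hs) [-> ->].
- by case.
- move=> t ts IHt IHts [//|t' ts'] s s' [hs] /=.
  by rewrite -!catA => /IHt [->] /(IHts _ _ _ hs) [-> ->].
Qed.

Lemma enc_inj : injective enc.
Proof. by move=> t t' h; have [] := @enc_prefix_code t t' [::] [::]; rewrite ?h. Qed.

HB.instance Definition _ := Equality.copy tree (inj_type enc_inj).

Lemma eq_enc (s t : tree) : (enc s == enc t) = (s == t).
Proof. by apply/eqP/eqP => [/enc_inj|->]. Qed.

Lemma lexle_total : total lexle.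
Proof.
elim=> [//|a s IH] [|b t] //=; have := IH t.
by case: (ltngtP a b) => //= _; rewrite orbF.
Qed.

Lemma lexle_trans : transitive lexle.
Proof.
elim=> [|b t IH] [|a s] [|c u] //= /orP[ab|/andP[/eqP-> st]] /orP[bc|/andP[/eqP<- tu]].
- by rewrite (ltn_trans ab bc).
- by rewrite ab.
- by rewrite bc.
- by rewrite eqxx (IH _ _ st tu) orbT.
Qed.

Lemma lexle_anti : antisymmetric lexle.
Proof.
elim=> [|a s IH] [|b t] //=.
by case: (ltngtP a b) => //= -> /IH ->.
Qed.

Lemma tle_total : total tle.
Proof. by move=> s t; exact: lexle_total. Qed.

Lemma tle_trans : transitive tle.
Proof. by move=> s t u; exact: lexle_trans. Qed.

Lemma tle_anti : antisymmetric tle.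
Proof. by move=> s t /lexle_anti /enc_inj. Qed.

Lemma canonical_Node ts : canonicalb (Node ts) = sorted tle ts && all canonicalb ts.
Proof. by []. Qed.

Lemma canonical_child t v : canonicalb t -> v \in children t -> canonicalb v.
Proof. by case: t => ts /andP[_ /allP h] /h. Qed.

Lemma canonical_canon t : canonicalb t -> Defs.canon t = t.
Proof.
move: t; apply: (@tree_list_ind _ (fun ts => all canonicalb ts -> map Defs.canon ts = ts)) => //=.
- move=> ts IH /andP[hs /IH ->]; congr Node; exact: sorted_sort tle_trans _ hs.
- by move=> t ts IHt IHts /andP[/IHt -> /IHts ->].
Qed.

Lemma bprod_canonicalE u v : canonicalb u -> canonicalb v ->
  bprod u v = Node (sort tle (v :: children u)).
Proof.
case: u => us /= /andP[_ /allP hu] hv; congr (Node (sort _ (_ :: _))).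
  exact: canonical_canon.
by apply: map_id_in => w /hu /canonical_canon.
Qed.

Lemma perm_children_bprod u v : canonicalb u -> canonicalb v ->
  perm_eq (children (bprod u v)) (v :: children u).
Proof. by move=> hu hv; rewrite bprod_canonicalE //= perm_sort. Qed.

Lemma canonical_bprod u v : canonicalb u -> canonicalb v -> canonicalb (bprod u v).
Proof.
move=> hu hv; rewrite bprod_canonicalE // canonical_Node sort_sorted ?all_sort /=;
  last exact: tle_total.
by rewrite hv; case: u hu => us /andP[].
Qed.

Lemma tree_order_gt0 t : (0 < tree_order t)%N.
Proof. by case: t. Qed.

Lemma perm_sumn_order ts us : perm_eq ts us ->
  sumn (map tree_order ts) = sumn (map tree_order us).
Proof. by move=> h; rewrite !sumnE; apply: perm_big; apply: perm_map. Qed.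

Lemma order_bprod u v : canonicalb u -> canonicalb v ->
  tree_order (bprod u v) = (tree_order u + tree_order v)%N.
Proof.
move=> hu hv; have := perm_children_bprod hu hv.
case: (bprod u v) => ts /=; case: {hu} u => us /= /perm_sumn_order -> /=; lia.
Qed.

Lemma order_child v t : v \in children t -> (tree_order v < tree_order t)%N.
Proof.
by case: t => ts /= /perm_to_rem /perm_sumn_order ->; rewrite /=; lia.
Qed.

(** Both lists of children are sorted for an antisymmetric order, and such a list is determined by
    its multiset. *)
Lemma canonical_children_inj u w : canonicalb u -> canonicalb w ->
  perm_eq (children u) (children w) -> u = w.
Proof.
case: u w => us [ws] /andP[hu _] /andP[hw _] h.
by congr Node; exact: (sorted_eq tle_trans tle_anti).
Qed.

Lemma bprod_inj v u w : canonicalb v -> canonicalb u -> canonicalb w ->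
  bprod u v = bprod w v -> u = w.
Proof.
move=> hv hu hw e; apply: canonical_children_inj => //.
rewrite -(perm_cons v) -(permPl (perm_children_bprod hu hv)) e.
exact: perm_children_bprod.
Qed.

(** Inverse of grafting [v]: a single copy is deleted, and the remaining children stay sorted. *)
Definition prune (v t : tree) : tree := Node (rem v (children t)).

Lemma canonical_prune v t : canonicalb t -> canonicalb (prune v t).
Proof.
case: t => ts /andP[hs ha] /=; rewrite (subseq_sorted tle_trans (rem_subseq v ts)) //=.
by apply/allP => w /mem_rem; move/allP: ha; apply.
Qed.

Lemma bprod_prune v t : canonicalb t -> v \in children t -> bprod (prune v t) v = t.
Proof.
move=> ht hv; have hv' := canonical_child ht hv.
have hp := canonical_prune v ht.
apply: canonical_children_inj => //; first exact: canonical_bprod.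
apply: perm_trans (perm_children_bprod hp hv') _.
by rewrite perm_sym; exact: perm_to_rem.
Qed.

Lemma prune_bprod u v : canonicalb u -> canonicalb v -> prune v (bprod u v) = u.
Proof.
move=> hu hv; have h := perm_children_bprod hu hv.
have hvin : v \in children (bprod u v) by rewrite (perm_mem h) mem_head.
have hb := canonical_bprod hu hv.
by apply: (bprod_inj hv) (bprod_prune hb hvin) => //; exact: canonical_prune.
Qed.

(** * Enumeration of the trees of a given order *)

(** The fuel bounds hold because each vertex costs at most two units, one to open the node and one
    to extend a forest; a forest needs one more unit to reach its empty end. *)
Lemma mem_ptrees_pforests f :
  (forall n t, (2 * n <= f)%N -> (t \in ptrees f n) = (tree_order t == n)) /\
  (forall n ts, (2 * n < f)%N ->
     (ts \in pforests f n) = (sumn (map tree_order ts) == n)).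
Proof.
elim: f => [|f [IHt IHf]]; split.
- by case=> //= -[].
- by [].
- case=> [|n] [ts] hn /=; first by [].
  rewrite (mem_map (f := Node)); last by move=> ? ? [].
  rewrite IHf //; lia.
- case=> [|n] ts hn; first by case: ts => [//|[ts] us]; rewrite /= inE.
  change (pforests f.+1 n.+1) with
    (flatten [seq [seq t :: ts | t <- ptrees f i, ts <- pforests f (n.+1 - i)]
             | i <- iota 1 n.+1]).
  apply/flatten_mapP/eqP => [[i]|].
    rewrite mem_iota => hi /allpairsP [[t us] [/= ht hus ->]] /=.
    move: ht hus; rewrite IHt; last lia.
    rewrite IHf; last lia.
    move=> /eqP -> /eqP ->; lia.
  case: ts => [//|t ts]; rewrite [sumn _]/= => h; have := tree_order_gt0 t => h0.
  exists (tree_order t); first by rewrite mem_iota; lia.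
  apply/allpairsP; exists (t, ts); split=> //=.
    rewrite IHt //; lia.
  rewrite IHf; last by lia.
  by apply/eqP; lia.
Qed.

Lemma uniq_flatten_keyed (S T : eqType) (A : S -> seq T) (key : T -> S) (s : seq S) :
  uniq s -> {in s, forall i, uniq (A i)} ->
  (forall i x, i \in s -> x \in A i -> key x = i) -> uniq (flatten (map A s)).
Proof.
elim: s => //= i s IH /andP[hi hs] hA hk.
rewrite cat_uniq hA ?mem_head //= IH //; first last.
- by move=> j x hj; apply: hk; rewrite inE hj orbT.
- by move=> j hj; apply: hA; rewrite inE hj orbT.
rewrite andbT; apply/hasPn => x /flatten_mapP[j hj hx]; apply/negP => hx'.
by case/negP: hi; rewrite -(hk i x) ?mem_head // (hk j x) ?inE ?hj ?orbT.
Qed.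

Lemma uniq_ptrees_pforests f :
  (forall n, (2 * n <= f)%N -> uniq (ptrees f n)) /\
  (forall n, (2 * n < f)%N -> uniq (pforests f n)).
Proof.
elim: f => [|f [IHt IHf]]; split => //.
- case=> [//|n] hn /=; rewrite map_inj_uniq; first by apply: IHf; lia.
  by move=> ? ? [].
- case=> [//|n] hn.
  (* The order of the first tree recovers the index of the block; every forest in a block is
     nonempty, so the default [leaf] is never reached. *)
  apply: (@uniq_flatten_keyed _ _ _ (fun ts => tree_order (head leaf ts)) (iota 1 n.+1)).
  + exact: iota_uniq.
  + move=> i; rewrite mem_iota => hi.
    apply: allpairs_uniq; [apply: IHt; lia|apply: IHf; lia|].
    by move=> [t ts] [u us] _ _ /= [-> ->].
  + move=> i us; rewrite mem_iota => hi /allpairsP [[t ts] [/= ht _ ->]] /=.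
    by move: ht; rewrite (mem_ptrees_pforests f).1; [move=> /eqP -> | lia].
Qed.

Lemma mem_trees_of_order n t :
  (t \in trees_of_order n) = canonicalb t && (tree_order t == n).
Proof.
by rewrite mem_filter (mem_ptrees_pforests _).1 //; lia.
Qed.

Lemma trees_of_order_uniq n : uniq (trees_of_order n).
Proof. by apply/filter_uniq/(uniq_ptrees_pforests _).1; lia. Qed.

(** This list has two uses: it contains both factors of every Butcher product of order n, and, being
    closed under children, it indexes the coordinates of the test field. *)
Definition trees_below (n : nat) : seq tree :=
  flatten [seq trees_of_order k | k <- iota 0 n].

Lemma mem_trees_below n t :
  (t \in trees_below n) = canonicalb t && (tree_order t < n)%N.
Proof.
apply/flatten_mapP/andP => [[k]|[ht hn]].
  by rewrite mem_iota mem_trees_of_order => ? /andP[-> /eqP ->].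
by exists (tree_order t); rewrite ?mem_iota ?mem_trees_of_order ?ht ?eqxx //.
Qed.

Lemma trees_below_uniq n : uniq (trees_below n).
Proof.
apply: (@uniq_flatten_keyed _ _ _ tree_order) => [|k _|k t _].
- exact: iota_uniq.
- exact: trees_of_order_uniq.
- by rewrite mem_trees_of_order => /andP[_ /eqP].
Qed.

(** * The symmetry coefficient *)

Definition mult_fact (ts : seq tree) : nat :=
  \prod_(e <- undup ts) (count_mem e ts)`!.

Lemma sigma_canonical ts : all canonicalb ts ->
  sigma (Node ts) = (\prod_(t <- ts) sigma t * mult_fact ts)%N.
Proof.
move=> /allP hts; rewrite /= big_map; congr (_ * _)%N.
have -> : [seq enc (Defs.canon s) | s <- ts] = map enc ts.
  by apply/eq_in_map => s /hts /canonical_canon ->.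
rewrite (undup_map_inj enc_inj) big_map; apply: eq_bigr => e _; congr (_ `!).
by apply: eq_in_count => s /hts /canonical_canon ->; rewrite eq_enc.
Qed.

Lemma mult_fact_perm ts us : perm_eq ts us -> mult_fact ts = mult_fact us.
Proof.
move=> h; rewrite /mult_fact (perm_big _ (perm_undup (perm_mem h))).
by apply: eq_bigr => e _; rewrite (permP h).
Qed.

(** Only the factor of [v] changes, from m! to (m+1)!, where the old multiplicity m may be 0. *)
Lemma mult_fact_cons v us :
  mult_fact (v :: us) = (mult_fact us * (count_mem v us).+1)%N.
Proof.
rewrite /mult_fact /=; case: ifP => hv; last first.
  rewrite big_cons /= eqxx (count_memPn (negbT hv)) addn0 mul1n muln1.
  rewrite [LHS]big_seq [RHS]big_seq; apply: eq_bigr => e.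
  rewrite mem_undup; case: eqP => [<-|//]; by rewrite hv.
rewrite (bigD1_seq v) ?mem_undup ?undup_uniq //= [in RHS](bigD1_seq v) ?mem_undup ?undup_uniq //=.
rewrite eqxx add1n factS -mulnA [RHS]mulnC; congr (_ * (_ * _))%N.
by apply: eq_bigr => e; rewrite eq_sym => /negbTE ->.
Qed.

(** The last factor is the multiplicity of [v] among the children of the product; it will cancel the
    number of ways to mark a child equal to [v]. *)
Lemma sigma_bprod u v : canonicalb u -> canonicalb v ->
  sigma (bprod u v) = (sigma u * sigma v * (count_mem v (children u)).+1)%N.
Proof.
move=> hu hv; have hb := canonical_bprod hu hv.
have := perm_children_bprod hu hv; case: (bprod u v) hb => ts hts.
case: u hu => us hus /= h.
rewrite -/(sigma (Node ts)) -/(sigma (Node us)) !sigma_canonical; last first.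
- by case/andP: hts.
- by case/andP: hus.
rewrite (perm_big _ h) /= big_cons (mult_fact_perm h) mult_fact_cons.
by rewrite mulnA; congr (_ * _)%N; rewrite -mulnA mulnC.
Qed.

Lemma sigma_gt0 t : canonicalb t -> (0 < sigma t)%N.
Proof.
move: t; apply: (@tree_list_ind _ (fun ts => all canonicalb ts ->
  0 < \prod_(t <- ts) sigma t)%N) => [ts IH /andP[_ hts]||t ts IHt IHts /andP[/IHt h1 /IHts h2]].
- rewrite sigma_canonical // muln_gt0 IH //= /mult_fact.
  by rewrite prodn_gt0 // => e; rewrite fact_gt0.
- by rewrite big_nil.
- by rewrite big_cons muln_gt0 h1.
Qed.

(** * Choosing one child of a tree *)

(** Index set of the Leibniz sum: one entry per position, so equal elements are listed with
    repetition. *)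
Fixpoint picks (T : Type) (s : seq T) : seq (T * seq T) :=
  if s is x :: s' then (x, s') :: [seq (p.1, x :: p.2) | p <- picks s'] else [::].

Lemma picks_map (T U : Type) (h : T -> U) (s : seq T) :
  picks (map h s) = [seq (h p.1, map h p.2) | p <- picks s].
Proof.
elim: s => //= x s ->; congr (_ :: _); rewrite -!map_comp.
exact: eq_map.
Qed.

(** [rem] deletes the first occurrence while [picks] deletes the chosen one. In a sorted list equal
    trees are adjacent, so the remaining lists coincide. *)
Lemma picks_sorted ts : sorted tle ts ->
  picks ts = [seq (v, rem v ts) | v <- ts].
Proof.
elim: ts => //= x ts IH hx; rewrite eqxx; congr (_ :: _).
rewrite IH ?(path_sorted hx) // -map_comp; apply/eq_in_map => v hv /=.
case: eqP => // e; move: hv; rewrite -{v}e => hv; congr (_, _).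
case: ts hx hv {IH} => //= y ts /andP[hxy hy]; case: eqP => [->//|ne].
rewrite inE => /orP[/eqP/esym//|hx]; case: ne; apply: tle_anti; rewrite hxy andbT.
by have /allP := order_path_min tle_trans hy; apply.
Qed.

Lemma sum_count (V : nmodType) (ts U : seq tree) (H : tree -> V) :
  uniq U -> {subset ts <= U} ->
  \sum_(v <- ts) H v = \sum_(v <- U) H v *+ count_mem v ts.
Proof.
move=> hU; elim: ts => [|t ts IH] hsub.
  by rewrite big_nil big1 // => v _; rewrite mulr0n.
rewrite big_cons IH; last by move=> v hv; apply: hsub; rewrite inE hv orbT.
under [RHS]eq_bigr do rewrite /= mulrnDr.
rewrite big_split /=; congr (_ + _).
rewrite (bigD1_seq t) ?hsub ?mem_head //= eqxx mulr1n big1 ?addr0 // => v.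
by rewrite eq_sym => /negbTE ->; rewrite mulr0n.
Qed.

(* A tree t with a marked child v is the same as the pair (u, v) with t = u o v;
   the multiplicity of v in t is absorbed by the symmetry coefficients. *)
Lemma sum_picks_bprod (R : realType) (W : lmodType R) (b : tree -> R) n
    (H : tree -> tree -> W) :
  \sum_(t <- trees_of_order n) (b t / (sigma t)%:R) *:
     (\sum_(p <- picks (children t)) H p.1 (Node p.2)) =
  \sum_(v <- trees_below n)
    \sum_(u <- trees_below n | (tree_order u + tree_order v == n)%N)
      (b (bprod u v) / ((sigma u)%:R * (sigma v)%:R)) *: H v u.
Proof.
(* First group the positions of each t by the tree found there, which produces the multiplicity as a
   weight. *)
transitivity (\sum_(t <- trees_of_order n) \sum_(v <- trees_below n | v \in children t)
   (b t / (sigma t)%:R * (count_mem v (children t))%:R) *: H v (prune v t)).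
  rewrite [LHS]big_seq [RHS]big_seq; apply: eq_bigr => t.
  rewrite mem_trees_of_order => /andP[ht /eqP <-].
  rewrite (_ : picks _ = [seq (v, rem v (children t)) | v <- children t]); last first.
    by apply: picks_sorted; case: t ht => ts /andP[].
  rewrite big_map (sum_count _ (trees_below_uniq (tree_order t))); last first.
    move=> v hv; rewrite mem_trees_below order_child // andbT.
    exact: canonical_child hv.
  rewrite scaler_sumr [RHS]big_mkcond; apply: eq_bigr => v _.
  case: ifPn => [_|/count_memPn ->]; last by rewrite mulr0n scaler0.
  by rewrite -[_ *+ count_mem _ _]scaler_nat scalerA.
(* For fixed v, grafting v is a bijection from the trees u of complementary order onto the trees t
   having v as a child, with inverse [prune v]. *)
rewrite (exchange_big_dep xpredT) //= [LHS]big_seq [RHS]big_seq; apply: eq_bigr => v.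
rewrite mem_trees_below => /andP[hv _].
rewrite -big_filter (perm_big (map (bprod^~ v)
  [seq u <- trees_below n | (tree_order u + tree_order v == n)%N])); last first.
  apply: uniq_perm.
  - exact/filter_uniq/trees_of_order_uniq.
  - rewrite map_inj_in_uniq; first exact/filter_uniq/trees_below_uniq.
    move=> u w; rewrite !mem_filter !mem_trees_below => /and3P[_ hu _] /and3P[_ hw _].
    exact: bprod_inj.
  - move=> t; rewrite mem_filter mem_trees_of_order; apply/and3P/mapP.
      move=> [hvt ht /eqP hn]; exists (prune v t); last by rewrite bprod_prune.
      have hp := canonical_prune v ht.
      have := order_bprod hp hv; rewrite bprod_prune // hn => ->.
      rewrite mem_filter mem_trees_below eqxx hp /=; have := tree_order_gt0 v; lia.
    move=> [u]; rewrite mem_filter mem_trees_below => /and3P[/eqP h hu _ ->].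
    split; last by rewrite order_bprod // h.
      by rewrite (perm_mem (perm_children_bprod hu hv)) mem_head.
    exact: canonical_bprod.
rewrite big_map big_filter; rewrite [LHS]big_seq_cond [RHS]big_seq_cond.
apply: eq_bigr => u; rewrite mem_trees_below => /andP[/andP[hu _] _].
rewrite prune_bprod // sigma_bprod //; congr (_ *: _).
have /permP -> := perm_children_bprod hu hv; rewrite /= eqxx add1n.
rewrite !natrM; set c := _.+1%:R; have hc : c != 0 by rewrite pnatr_eq0.
by rewrite invfM -!mulrA mulVf // mulr1.
Qed.

(** * Smooth maps *)

Section Smooth.
Variable R : realType.
Implicit Types U V W : normedModType R.

(** The tangent map inside [smoothN], written with projections so that tangents of composites and
    pairs rewrite directly. *)
Definition tangent V W (F : V -> W) (p : V * V) : W * W := (F p.1, 'd F (p.1 : V) p.2).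

Lemma smoothNS n V W (F : V -> W) :
  smoothN n.+1 F <-> (forall x, differentiable F x) /\ smoothN n (tangent F).
Proof.
have -> : tangent F = fun p : V * V => let: (x, v) := p in (F x, 'd F x v).
  by apply/funext => -[].
by [].
Qed.

Lemma smoothN_continuous n V W (F : V -> W) : smoothN n F -> continuous F.
Proof.
case: n => [//|n] [h _] x; exact: differentiable_continuous.
Qed.

(** By the chain rule the tangent construction is functorial, T(G o F) = TG o TF, so the induction
    closes. *)
Lemma smoothN_comp n U V W (F : U -> V) (G : V -> W) :
  smoothN n F -> smoothN n G -> smoothN n (G \o F).
Proof.
elim: n U V W F G => [|n IH] U V W F G.
  by move=> hF hG x; apply: continuous_comp; [exact: hF|exact: hG].
move=> /smoothNS [dF hF] /smoothNS [dG hG]; apply/smoothNS; split.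
  by move=> x; apply: differentiable_comp.
rewrite (_ : tangent _ = tangent G \o tangent F); first exact: IH.
by apply/funext => -[x v]; rewrite /tangent /= diff_comp.
Qed.

Lemma continuous_pair U V W (F : U -> V) (G : U -> W) :
  continuous F -> continuous G -> continuous (fun x => (F x, G x)).
Proof. by move=> hF hG x; apply: cvg_pair; [exact: hF|exact: hG]. Qed.

Lemma diff_linear V W (f : V -> W) x : linear f -> continuous f ->
  differentiable f x /\ 'd f x = f :> (V -> W).
Proof.
move=> lf cf.
pose L : {linear V -> W} := HB.pack f (GRing.isLinear.Build _ _ _ _ f lf).
by split; [exact: (@linear_differentiable _ _ _ L)|exact: (@diff_lin _ _ _ L)].
Qed.

Lemma smoothN_linear n V W (f : V -> W) : linear f -> continuous f -> smoothN n f.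
Proof.
elim: n V W f => [//|n IH] V W f lf cf.
apply/smoothNS; split; first by move=> x; have [] := diff_linear x lf cf.
rewrite (_ : tangent f = fun p => (f p.1, f p.2)); last first.
  by apply/funext => -[x v]; rewrite /tangent /= (diff_linear x lf cf).2.
apply: IH; first by move=> k [x v] [y w]; rewrite /= !lf.
apply: continuous_pair => p.
  by apply: continuous_comp; [exact: cvg_fst|exact: cf].
by apply: continuous_comp; [exact: cvg_snd|exact: cf].
Qed.

Lemma smoothN_id n V : smoothN n (@id V).
Proof. by apply: smoothN_linear => // x; exact: cvg_id. Qed.

Lemma smoothN_fst n V W : smoothN n (@fst V W).
Proof. by apply: smoothN_linear => // x; exact: cvg_fst. Qed.

Lemma smoothN_snd n V W : smoothN n (@snd V W).
Proof. by apply: smoothN_linear => // x; exact: cvg_snd. Qed.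

Lemma smoothN_cst n V W (a : W) : smoothN n (fun _ : V => a).
Proof.
elim: n V W a => [|n IH] V W a; first by move=> x; exact: cvg_cst.
apply/smoothNS; split; first by move=> x; exact: differentiable_cst.
rewrite (_ : tangent _ = fun=> (a, 0)); first exact: IH.
by apply/funext => -[x v]; rewrite /tangent (@diff_cst _ V W a x).
Qed.

Lemma smoothN_pair n U V W (F : U -> V) (G : U -> W) :
  smoothN n F -> smoothN n G -> smoothN n (fun x => (F x, G x)).
Proof.
elim: n U V W F G => [|n IH] U V W F G; first exact: continuous_pair.
move=> /smoothNS [dF hF] /smoothNS [dG hG]; apply/smoothNS; split.
  by move=> x; apply: differentiable_pair.
(* The tangent of a pair is the pair of tangents up to exchanging the two middle factors, a
   continuous linear map. *)
pose swap (p : (V * V) * (W * W)) := ((p.1.1, p.2.1), (p.1.2, p.2.2)).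
rewrite (_ : tangent _ = swap \o (fun p => (tangent F p, tangent G p))); last first.
  by apply/funext => -[x v]; rewrite /tangent /= diff_pair.
apply: smoothN_comp; first exact: IH.
apply: smoothN_linear; first by move=> k [[? ?] [? ?]] [[? ?] [? ?]].
have c1 : continuous (@fst (V * V) (W * W)) by move=> x; exact: cvg_fst.
have c2 : continuous (@snd (V * V) (W * W)) by move=> x; exact: cvg_snd.
apply: continuous_pair; apply: continuous_pair => p.
- by apply: (continuous_comp (c1 p)); exact: cvg_fst.
- by apply: (continuous_comp (c2 p)); exact: cvg_fst.
- by apply: (continuous_comp (c1 p)); exact: cvg_snd.
- by apply: (continuous_comp (c2 p)); exact: cvg_snd.
Qed.

Lemma smoothN_add n V W (F G : V -> W) :
  smoothN n F -> smoothN n G -> smoothN n (fun x => F x + G x).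
Proof.
move=> hF hG; pose A (p : W * W) := p.1 + p.2.
apply: (@smoothN_comp n _ _ _ (fun x => (F x, G x)) A); first exact: smoothN_pair.
apply: smoothN_linear; last by move=> p; apply: cvgD; [exact: cvg_fst|exact: cvg_snd].
by move=> k [a c] [a' c']; rewrite /A /= scalerDr addrACA.
Qed.

Lemma smoothN_sum n V W (I : Type) (r : seq I) (F : I -> V -> W) :
  (forall i, smoothN n (F i)) -> smoothN n (fun x => \sum_(i <- r) F i x).
Proof.
move=> h; elim: r => [|i r IH].
  by under eq_fun do rewrite big_nil; exact: smoothN_cst.
by under eq_fun do rewrite big_cons; exact: smoothN_add.
Qed.

(** The tangent of multiplication is again built from multiplication, addition and projections, so
    the induction hypothesis applies to it. *)
Lemma smoothN_mul n : smoothN n (fun p : R * R => p.1 * p.2 : R).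
Proof.
elim: n => [|n IH].
  by move=> p; apply: cvgM; [exact: cvg_fst|exact: cvg_snd].
apply/smoothNS; split => [p|]; first by apply: ex_diff.
pose h (p : R * R) : R := p.1 * p.2.
rewrite (_ : tangent _ = fun p : (R * R) * (R * R) =>
  (h p.1, h (p.1.1, p.2.2) + h (p.2.1, p.1.2))); last first.
  apply/funext => -[[x y] [v w]]; rewrite /tangent /h /=; congr (_, _).
  rewrite (_ : 'd _ _ = (fun q : R * R => x * q.2 + q.1 * y) :> (R * R -> R)) //.
  by rewrite diff_val.
have s1 := smoothN_fst n (R * R)%type (R * R)%type.
have s2 := smoothN_snd n (R * R)%type (R * R)%type.
have p1 := smoothN_fst n R R.
have p2 := smoothN_snd n R R.
apply: smoothN_pair; first exact: (smoothN_comp s1 IH).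
apply: smoothN_add.
  apply: (@smoothN_comp n _ _ _ _ h _ IH).
  by apply: smoothN_pair; [exact: (smoothN_comp s1 p1)|exact: (smoothN_comp s2 p2)].
apply: (@smoothN_comp n _ _ _ _ h _ IH).
by apply: smoothN_pair; [exact: (smoothN_comp s2 p1)|exact: (smoothN_comp s1 p2)].
Qed.

Lemma smooth_mul V (f g : V -> R) :
  smooth f -> smooth g -> smooth (fun x => f x * g x).
Proof.
move=> hf hg n.
apply: (@smoothN_comp n _ _ _ (fun x => (f x, g x)) _ _ (smoothN_mul n)).
by apply: smoothN_pair; [exact: hf|exact: hg].
Qed.

Lemma smooth_differentiable V W (F : V -> W) x : smooth F -> differentiable F x.
Proof. by move=> /(_ 1%N) []. Qed.

(** The map is the second component of TF along y -> (h y, k y), so order n uses order n + 1 of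
    [F]. *)
Lemma smooth_diff U V W (F : V -> W) (h k : U -> V) :
  smooth F -> smooth h -> smooth k -> smooth (fun y => derive F (h y) (k y)).
Proof.
move=> hF hh hk n.
have hT : smoothN n (tangent F) by have /smoothNS [] := hF n.+1.
rewrite (_ : (fun y => _) = snd \o (tangent F \o (fun y => (h y, k y)))).
  apply: smoothN_comp; last exact: smoothN_snd.
  by apply: smoothN_comp => //; apply: smoothN_pair; [exact: hh|exact: hk].
by apply/funext => y; rewrite /= deriveE //; exact: smooth_differentiable.
Qed.

Lemma smooth_derive V W (F : V -> W) v : smooth F -> smooth (fun y => derive F y v).
Proof.
move=> hF; apply: smooth_diff => // n; [exact: smoothN_id|exact: smoothN_cst].
Qed.

Lemma smooth_Dn V W (F : V -> W) vs : smooth F -> smooth (Dn F vs).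
Proof. by move=> hF; elim: vs => //= v vs; exact: smooth_derive. Qed.

Lemma smooth_derivable V W (F : V -> W) x v : smooth F -> derivable F x v.
Proof. by move=> hF; apply/diff_derivable/smooth_differentiable. Qed.

Lemma derive_linear V W (P : V -> W) x v : linear P -> continuous P -> derive P x v = P v.
Proof.
move=> lP cP; have [dP eP] := diff_linear x lP cP.
by rewrite deriveE // eP.
Qed.

Lemma derive_linear_comp U V W (P : V -> W) (F : U -> V) x v :
  linear P -> continuous P -> differentiable F x ->
  derive (P \o F) x v = P (derive F x v).
Proof.
move=> lP cP dF; have [dP eP] := diff_linear (F x) lP cP.
by rewrite (deriveE _ (differentiable_comp dF dP)) (diff_comp dF dP) /= eP (deriveE _ dF).
Qed.

Lemma derive_comp_linear U V W (L : U -> V) (F : V -> W) x v :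
  linear L -> derive (F \o L) x v = derive F (L x) (L v).
Proof.
move=> lL; rewrite /derive.
suff -> : (fun h : R => h^-1 *: (((F \o L) \o shift x) (h *: v) - (F \o L) x)) =
  (fun h => h^-1 *: ((F \o shift (L x)) (h *: L v) - F (L x))) by [].
by apply/funext => h /=; rewrite lL.
Qed.

Lemma Dn_linear_comp U V W (P : V -> W) (F : U -> V) vs x :
  linear P -> continuous P -> smooth F -> Dn (P \o F) vs x = P (Dn F vs x).
Proof.
move=> lP cP hF; elim: vs x => //= v vs IH x.
rewrite -derive_linear_comp //; last exact/smooth_differentiable/smooth_Dn.
by congr (derive _ _ _); apply/funext => y; exact: IH.
Qed.

Lemma Dn_comp_linear U V W (L : U -> V) (F : V -> W) vs x :
  linear L -> Dn (F \o L) vs x = Dn F (map L vs) (L x).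
Proof.
move=> lL; elim: vs x => //= v vs IH x.
rewrite -derive_comp_linear //.
by congr (derive _ _ _); apply/funext => y; exact: IH.
Qed.

Lemma derive_pair U V W (F : U -> V) (G : U -> W) x v :
  differentiable F x -> differentiable G x ->
  derive (fun y => (F y, G y)) x v = (derive F x v, derive G x v).
Proof.
by move=> dF dG; rewrite !deriveE ?diff_pair //; exact: differentiable_pair.
Qed.

Lemma deriveDr V W (F : V -> W) x u v : differentiable F x ->
  derive F x (u + v) = derive F x u + derive F x v.
Proof. by move=> dF; rewrite !deriveE // linearD. Qed.

Lemma deriveZr V W (F : V -> W) x k v : differentiable F x ->
  derive F x (k *: v) = k *: derive F x v.
Proof. by move=> dF; rewrite !deriveE // linearZ. Qed.

Lemma derive_sumr V W (F : V -> W) x (I : Type) (r : seq I) (h : I -> V) :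
  differentiable F x -> derive F x (\sum_(i <- r) h i) = \sum_(i <- r) derive F x (h i).
Proof.
by move=> dF; rewrite deriveE // linear_sum; apply: eq_bigr => i _; rewrite deriveE.
Qed.

(* The scalar function [t |-> |f t - f y|] also has zero derivative. *)
Lemma zero_derivative_cst W (f : R -> W) x y :
  (forall t, is_derive t (1 : R) f 0) -> f x = f y.
Proof.
move=> hf; apply/eqP; rewrite -subr_eq0 -normr_eq0 -[X in _ == X](normr0 W) -(subrr (f y)).
apply/eqP; apply: (is_derive_0_is_cst (f := fun t => `|f t - f y|)) => t.
suff h : (fun h => h^-1 *: (((fun t => `|f t - f y|) \o shift t) (h *: (1 : R)) -
    `|f t - f y|)) @ 0^' --> (0 : R).
  by split; [apply/cvg_ex; exists 0 | exact/cvg_lim].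
have [+ +] := hf t; rewrite /derivable /derive => /= cv e.
have : (fun h => h^-1 *: ((f \o shift t) (h *: (1 : R)) - f t)) @ 0^' --> (0 : W).
  by rewrite -e.
move=> /cvgr0_norm_lt h; apply/cvgr0Pnorm_lt => _/posnumP[eps].
near=> k.
apply: (@le_lt_trans _ _ `|k^-1 *: ((f \o shift t) (k *: (1 : R)) - f t)|).
  (* The reverse triangle inequality bounds the difference quotient of the norm by the norm of the
     difference quotient. *)
  rewrite /= /GRing.scale /= !normrM normrZ.
  apply: ler_wpM2l => //; apply: le_trans (ler_dist_dist _ _) _.
  by rewrite opprB addrA subrK.
by near: k; apply: h.
Unshelve. all: by end_near. Qed.

End Smooth.

(** * Quadratic maps *)

Section Quadratic.
Variable R : realType.
Implicit Types U V W : normedModType R.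

Lemma derive_sum_smooth V W (I : Type) (r : seq I) (F : I -> V -> W) x v :
  (forall i, smooth (F i)) ->
  derive (fun y => \sum_(i <- r) F i y) x v = \sum_(i <- r) derive (F i) x v.
Proof.
move=> hF; elim: r => [|i r IH].
  by under eq_fun do rewrite big_nil; rewrite big_nil; exact: derive_cst.
under eq_fun do rewrite big_cons; rewrite big_cons -IH.
apply: deriveD; apply: smooth_derivable => // n.
by apply: smoothN_sum => j; exact: hF.
Qed.

(** Identifies the difference quotients, which reduces directional derivatives to one-variable
    calculus on the line x + t v. *)
Lemma line_quotient V W (h : V -> W) x v t :
  (fun k : R => k^-1 *: (((fun s : R => h (x + s *: v)) \o shift t) (k *: (1 : R)) -
     h (x + t *: v))) =
  (fun k => k^-1 *: ((h \o shift (x + t *: v)) (k *: v) - h (x + t *: v))).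
Proof.
apply/funext => k /=; congr (_ *: (h _ - _)).
by rewrite scalerDl [_ *: (1 : R)]mulr1 addrCA.
Qed.

Lemma derivable_line V W (h : V -> W) x v t :
  derivable (fun s : R => h (x + s *: v)) t 1 = derivable h (x + t *: v) v.
Proof. by rewrite /derivable line_quotient. Qed.

Lemma derive_line V W (h : V -> W) x v t :
  derive (fun s : R => h (x + s *: v)) t 1 = derive h (x + t *: v) v.
Proof. by rewrite /derive line_quotient. Qed.

Lemma is_derive_scale (W : normedModType R) (q : R -> R) (t dq : R) (c : W) :
  is_derive t 1 q dq -> is_derive t 1 (fun s => q s *: c) (dq *: c).
Proof.
move=> [dq1 dq2]; have dq3 : differentiable q t by exact/derivable1_diffP.
pose P (r : R) := r *: c.
have lP : linear P by move=> k a d; rewrite /P scalerDl scalerA.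
have cP : continuous P by move=> r; apply: cvgZr_tmp; exact: cvg_id.
have e := @derive_linear_comp _ _ _ _ P q t 1 lP cP dq3.
split; last by rewrite -dq2 -/(P _) -e.
apply/derivable1_diffP; apply: (@differentiable_comp _ _ _ _ q P) => //.
Qed.

(** On the line, [h] minus the expected quadratic polynomial has zero derivative; comparing its
    values at t = 1 and t = 0 gives the formula. *)
Lemma line_taylor2 V W (h : V -> W) x v (c d : W) :
  (forall y, derivable h y v) ->
  (forall t : R, derive h (x + t *: v) v = c + t *: d) ->
  h (x + v) = h x + c + 2^-1 *: d.
Proof.
move=> dh eh.
pose f (t : R) := h (x + t *: v) - (t *: c + (2^-1 * t ^+ 2) *: d).
have hf (t : R) : is_derive t (1 : R) f 0.
  have h1 : is_derive t (1 : R) (fun s : R => h (x + s *: v)) (c + t *: d).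
    by split; rewrite ?derivable_line ?derive_line.
  have h2 : is_derive t (1 : R) (fun s : R => s *: c) (1 *: c) by exact: is_derive_scale.
  have h3 : is_derive t (1 : R) (fun s : R => (2^-1 * s ^+ 2) *: d) (t *: d).
    apply: is_derive_scale; apply: is_derive_eq.
    by rewrite /GRing.scale /=; field.
  by apply: is_derive_eq; rewrite scale1r subrr.
have := zero_derivative_cst 1 0 hf.
rewrite /f !scale1r !scale0r expr1n expr0n mulr1 mulr0 scale0r !addr0 subr0.
by move=> /eqP; rewrite subr_eq => /eqP ->; rewrite addrA.
Qed.

Lemma line_affine V W (h : V -> W) x v (c : W) :
  (forall y, derivable h y v) -> (forall y, derive h y v = c) ->
  h (x + v) = h x + c.
Proof.
move=> dh eh; rewrite (@line_taylor2 _ _ h x v c 0) ?scaler0 ?addr0 // => t.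
by rewrite eh scaler0 addr0.
Qed.

(** The bilinear map B. The base point 0 is a mere choice for quadratic [F], whose second derivative
    is constant. *)
Definition hessian V W (F : V -> W) (u v : V) : W := Dn F [:: u; v] 0.

(** The difference quotient of s psi(s) at 0 is psi(s) itself, so continuity of [psi] gives the
    limit. *)
Lemma derive_scale0 W (psi : R -> W) : {for 0, continuous psi} ->
  is_derive (0 : R) (1 : R) (fun s => s *: psi s) (psi 0).
Proof.
move=> cpsi.
suff h : (fun h : R => h^-1 *: (((fun s => s *: psi s) \o shift 0) (h *: (1 : R)) -
    0 *: psi 0)) @ 0^' --> psi 0.
  by split; [apply/cvg_ex; exists (psi 0) | exact/cvg_lim].
have : psi @ 0^' --> psi 0 by exact: cvg_within_filter.
apply: cvg_trans; apply: near_eq_cvg; near=> k.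
rewrite /= addr0 [_ *: (1 : R)]mulr1 scale0r subr0 scalerA mulVf ?scale1r //.
by near: k; exact: nbhs_dnbhs_neq.
Unshelve. all: by end_near. Qed.

Section QuadraticMap.
Variables (V W : normedModType R) (F : V -> W).
Hypothesis qF : quadratic F.

Let sF : smooth F := qF.1.
Local Notation B := (hessian F).
Local Notation D := (derive F).

Lemma Dn2_quadratic u v x : Dn F [:: u; v] x = B u v.
Proof.
rewrite -[x]add0r (@line_affine _ _ (Dn F [:: u; v]) 0 x 0) ?addr0 // => y.
  by apply: smooth_derivable; exact: smooth_Dn.
exact: qF.2.
Qed.

Lemma derive_quadraticD x v w : D (x + v) w = D x w + B v w.
Proof.
apply: (@line_affine _ _ (fun y => D y w)) => y.
  by apply: smooth_derivable; exact: smooth_derive.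
by rewrite -(Dn2_quadratic v w y).
Qed.

(** Writing B as a difference of two differentials transfers their linearity and continuity to its
    second argument. *)
Lemma hessianE v w : B v w = D v w - D 0 w.
Proof. by rewrite -[in RHS](add0r v) derive_quadraticD addrC addKr. Qed.

Lemma hessian_linear_r v : linear (B v).
Proof.
move=> k a c; rewrite !hessianE !deriveDr ?deriveZr; try exact: smooth_differentiable.
by rewrite scalerBr opprD addrACA.
Qed.

Lemma diff_smooth_continuous x : continuous (D x).
Proof.
rewrite (_ : D x = 'd F x); first exact/diff_continuous/smooth_differentiable.
by apply/funext => v; rewrite deriveE //; exact: smooth_differentiable.
Qed.

Lemma diff_smooth_linear x : linear (D x).
Proof.
by move=> k a c; rewrite deriveDr ?deriveZr //; exact: smooth_differentiable.
Qed.

Lemma hessian_continuous_r v : continuous (B v).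
Proof.
rewrite (_ : B v = fun w => D v w - D 0 w); last by apply/funext => w; exact: hessianE.
by move=> w; apply: cvgB; exact: diff_smooth_continuous.
Qed.

Lemma hessianZl k v w : B (k *: v) w = k *: B v w.
Proof. by rewrite /hessian /= deriveZr //; exact/smooth_differentiable/smooth_derive. Qed.

Lemma quadratic_taylor x v : F (x + v) = F x + D x v + 2^-1 *: B v v.
Proof.
apply: line_taylor2 => [y|t]; first exact: smooth_derivable.
by rewrite derive_quadraticD hessianZl.
Qed.

(* Expand F (u + v) at u and at v. *)
Lemma hessianC u v : B u v = B v u.
Proof.
(* Every term of this expansion except [B a c] is symmetric in a and c. *)
have h (a c : V) : F (a + c) =
    F 0 + (D 0 a + D 0 c) + 2^-1 *: (B a a + B c c) + B a c.
  have hF := quadratic_taylor 0 a; have hD := derive_quadraticD 0 a c.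
  rewrite !add0r in hF hD; rewrite quadratic_taylor hF hD scalerDr !addrA.
  by rewrite [LHS](ACl (1 * 2 * 4 * 3 * 6 * 5)).
have := h u v; rewrite addrC h [D 0 v + _]addrC [B v v + _]addrC.
by move=> /addrI.
Qed.

Lemma derive_derive_quadratic (h : V -> V) y v : smooth h ->
  derive (fun x => D x (h x)) y v = D y (derive h y v) + B v (h y).
Proof.
move=> sh.
have e0 : y + (0 : R) *: v = y by rewrite scale0r addr0.
rewrite -{1}e0 -derive_line.
(* On the line, F'(y + s v) = F'(y) + s B(v, .): the first summand has a fixed linear map, the
   second is handled by [derive_scale0]. *)
rewrite (_ : (fun s : R => _) = (fun s : R => (D y \o h) (y + s *: v)) +
   (fun s : R => s *: B v (h (y + s *: v)))); last first.
  by apply/funext => s; rewrite derive_quadraticD hessianZl.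
have dDh : differentiable (D y \o h) y.
  apply: differentiable_comp; first exact: smooth_differentiable.
  by have [] := diff_linear (h y) (diff_smooth_linear y) (@diff_smooth_continuous y).
have cpsi : {for 0, continuous (fun s : R => B v (h (y + s *: v)))}.
  apply: (@continuous_comp _ _ _ (fun s : R => h (y + s *: v)) (B v));
    last exact: hessian_continuous_r.
  apply: (@continuous_comp _ _ _ (fun s : R => y + s *: v) h).
    by apply: cvgD; [exact: cvg_cst|apply: cvgZr_tmp; exact: cvg_id].
  exact: (smoothN_continuous (sh 0%N)).
have [d1 d2] := derive_scale0 cpsi.
rewrite deriveD //; last first.
  by rewrite derivable_line e0; exact: diff_derivable.
rewrite d2 derive_line e0 derive_linear_comp //.
- exact: diff_smooth_linear.
- exact: diff_smooth_continuous.
- exact: smooth_differentiable.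
Qed.

Lemma smooth_hessian (h : V -> V) v : smooth h -> smooth (fun x => B v (h x)).
Proof.
move=> sh n; apply: (@smoothN_comp _ n _ _ _ h (B v)); first exact: sh.
by apply: smoothN_linear; [exact: hessian_linear_r|exact: hessian_continuous_r].
Qed.

(** Leibniz rule: since F''' = 0, at most one direction can fall on F', and [picks] runs over the
    choice of that direction. *)
Lemma Dn_derive_quadratic (f : V -> V) vs y : smooth f ->
  Dn (fun x => D x (f x)) vs y =
  D y (Dn f vs y) + \sum_(p <- picks vs) B p.1 (Dn f p.2 y).
Proof.
move=> sf; elim: vs y => [|v vs IH] y; first by rewrite /= big_nil addr0.
rewrite [LHS]/= (_ : Dn _ vs = (fun x => D x (Dn f vs x)) +
    (fun x => \sum_(p <- picks vs) B p.1 (Dn f p.2 x))); last first.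
  by apply/funext => x; rewrite IH.
have sfn ws : smooth (Dn f ws) by exact: smooth_Dn.
rewrite deriveD; first last.
- apply: smooth_derivable => n; apply: smoothN_sum => p.
  exact: (smooth_hessian p.1 (sfn p.2) n).
- by apply: smooth_derivable; apply: smooth_diff => // n; exact: smoothN_id.
rewrite derive_derive_quadratic // derive_sum_smooth; last first.
  by move=> p; exact: smooth_hessian.
rewrite /= big_cons big_map /= -addrA; congr (_ + (_ + _)).
apply: eq_bigr => p _.
rewrite (@derive_linear_comp _ _ _ _ (B p.1) (Dn f p.2)) //.
- exact: hessian_linear_r.
- exact: hessian_continuous_r.
- exact: smooth_differentiable.
Qed.

End QuadraticMap.

(** * Elementary differentials of the augmented vector field *)

(** Each component of the field factors through the linear map [fst], so derivatives see only the
    first components of the directions. *)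
Lemma Dn_triangular V W (f : V -> V) (G : V -> W) ps p : smooth f -> smooth G ->
  Dn (fun q : V * W => (f q.1, G q.1)) ps p =
  (Dn f (map fst ps) p.1, Dn G (map fst ps) p.1).
Proof.
move=> sf sG; set g := fun q : V * W => _.
have sg : smooth g.
  move=> n; apply: smoothN_pair.
    exact: (@smoothN_comp _ n _ _ _ fst f (smoothN_fst n V W)).
  exact: (@smoothN_comp _ n _ _ _ fst G (smoothN_fst n V W)).
have l1 : linear (@fst V W) by [].
have l2 : linear (@snd V W) by [].
rewrite [LHS]surjective_pairing; congr (_, _).
  rewrite -(Dn_linear_comp (P := fst)) //; last by move=> x; exact: cvg_fst.
  exact: (Dn_comp_linear (L := fst) f).
rewrite -(Dn_linear_comp (P := snd)) //; last by move=> x; exact: cvg_snd.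
exact: (Dn_comp_linear (L := fst) G).
Qed.

Lemma elem_Node V (f : V -> V) ts x :
  elem f (Node ts) x = Dn f (map (fun s => elem f s x) ts) x.
Proof. by []. Qed.

Lemma elem_triangular V W (f : V -> V) (G : V -> W) t p : smooth f -> smooth G ->
  elem (fun q : V * W => (f q.1, G q.1)) t p =
  (elem f t p.1, Dn G (map (fun s => elem f s p.1) (children t)) p.1).
Proof.
move=> sf sG; move: t; apply: (@tree_list_ind _ (fun ts =>
  map fst (map (fun s => elem (fun q : V * W => (f q.1, G q.1)) s p) ts) =
  map (fun s => elem f s p.1) ts)) => [ts IH||t ts IHt IHts] //.
- by rewrite elem_Node Dn_triangular // IH.
- by rewrite /= IHts IHt.
Qed.

Lemma related_bseriesP (b : tree -> R) V W (F : V -> W) (f : V -> V) n :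
  quadratic F -> smooth f ->
  (related (fun y => (y, F y)) (bseries_order b n f)
     (bseries_order b n (fun p : V * W => (f p.1, derive F p.1 (f p.1))))) <->
  (forall y, \sum_(v <- trees_below n)
    \sum_(u <- trees_below n | (tree_order u + tree_order v == n)%N)
      (b (bprod u v) / ((sigma u)%:R * (sigma v)%:R)) *:
        hessian F (elem f v y) (elem f u y) = 0).
Proof.
move=> qF sf; have sF := qF.1.
set g := fun p : V * W => _.
(* The V-components always agree; the whole defect from equivariance is the Leibniz sum in the
   W-component. *)
suff h y : bseries_order b n g (y, F y) =
    derive (fun y => (y, F y)) y (bseries_order b n f y) +
    (0, \sum_(v <- trees_below n)
    \sum_(u <- trees_below n | (tree_order u + tree_order v == n)%N)
      (b (bprod u v) / ((sigma u)%:R * (sigma v)%:R)) *: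
        hessian F (elem f v y) (elem f u y)).
  split=> H y; have := H y; rewrite h.
    by move=> /esym/eqP; rewrite -subr_eq0 addrAC subrr add0r => /eqP [].
  by move=> ->; rewrite addr0.
rewrite derive_pair; [|exact: ex_diff|exact: smooth_differentiable].
have sG : smooth (fun y => derive F y (f y)).
  by apply: smooth_diff => // m; exact: smoothN_id.
have -> : bseries_order b n g (y, F y) = \sum_(t <- trees_of_order n)
   (b t / (sigma t)%:R) *: (elem f t y, derive F y (elem f t y) +
     \sum_(p <- picks (children t)) hessian F (elem f p.1 y) (elem f (Node p.2) y)).
  apply: eq_bigr => -[ts] _; congr (_ *: _).
  rewrite (elem_triangular (Node ts) (y, F y) sf sG); congr (_, _).
  by rewrite (Dn_derive_quadratic qF) //= picks_map big_map.
rewrite -(sum_picks_bprod b n (fun v u => hessian F (elem f v y) (elem f u y))).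
rewrite derive_id derive_sumr; last exact: smooth_differentiable.
have pair_sum (r : seq tree) (A : tree -> V) (C : tree -> W) :
    \sum_(t <- r) (A t, C t) = (\sum_(t <- r) A t, \sum_(t <- r) C t).
  elim: r => [|t r IH]; first by rewrite !big_nil.
  by rewrite !big_cons IH.
have scaler_pair (k : R) (v : V) (w : W) : k *: (v, w) = (k *: v, k *: w) by [].
under eq_bigr do rewrite scaler_pair.
rewrite pair_sum; congr (_, _); rewrite /= ?addr0 // -big_split /=.
apply: eq_bigr => t _; rewrite scalerDr deriveZr //; exact: smooth_differentiable.
Qed.

Lemma antisymmetric_equivariant (b : tree -> R) :
  (forall u v : tree, canonical_tree u -> canonical_tree v ->
     b (bprod u v) + b (bprod v u) = 0) ->
  quadratic_functionally_equivariant b.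
Proof.
move=> hb Y Z F qF f sf g n; apply/(related_bseriesP b n qF sf) => y.
set S := LHS.
(* Exchanging the names of u and v keeps B by symmetry and changes the sign of b. *)
have hS : S = - S.
  rewrite {1}/S (exchange_big_dep xpredT) //= -sumrN big_seq [RHS]big_seq.
  apply: eq_bigr => v; rewrite mem_trees_below => /andP[hv _].
  rewrite -sumrN big_seq_cond [RHS]big_seq_cond; apply: eq_big => [u|u]; first by rewrite addnC.
  rewrite mem_trees_below => /andP[/andP[hu _] _].
  rewrite hessianC // -scaleNr [(sigma v)%:R * _]mulrC; congr (_ *: _).
  by rewrite -mulNr; congr (_ / _); apply/eqP; rewrite -addr_eq0 hb.
have : 2 *: S = 0 by rewrite scaler_nat mulr2n {1}hS addNr.
by move=> /eqP; rewrite scaler_eq0 pnatr_eq0 => /eqP.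
Qed.

End Quadratic.

(** Equivariance is quantified over complete spaces, and the test field lives on row vectors. *)
HB.instance Definition _ (R : realType) (n : nat) := Complete.on 'rV[R]_n.

(** * Monomial vector fields with independent elementary differentials *)

Section Monomial.
Variable R : realType.

Lemma derive_mul (V : normedModType R) (f g : V -> R) x v : smooth f -> smooth g ->
  derive (fun y => f y * g y) x v = f x * derive g x v + g x * derive f x v.
Proof. by move=> sf sg; rewrite (@deriveM _ _ f g) //; exact: smooth_derivable. Qed.

(** [Dn] differentiates along the last vector first; peeling it off allows induction on the monomial
    being differentiated. *)
Lemma Dn_rcons (V W : normedModType R) (F : V -> W) vs v :
  Dn F (rcons vs v) = Dn (fun x => derive F x v) vs.
Proof. by elim: vs => //= w vs ->. Qed.

Lemma Dn_sum (V W : normedModType R) (I : Type) (r : seq I) (F : I -> V -> W) vs x :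
  (forall i, smooth (F i)) ->
  Dn (fun y => \sum_(i <- r) F i y) vs x = \sum_(i <- r) Dn (F i) vs x.
Proof.
move=> hF; elim: vs x => //= v vs IH x.
rewrite -derive_sum_smooth; last by move=> i; exact: smooth_Dn.
by congr (derive _ _ _); apply/funext => y; exact: IH.
Qed.

Lemma smooth_scale (V W : normedModType R) (h : V -> R) (w : W) :
  smooth h -> smooth (fun y => h y *: w).
Proof.
move=> sh n; apply: (@smoothN_comp _ n _ _ _ h (fun r : R => r *: w)); first exact: sh.
apply: smoothN_linear; first by move=> k a c; rewrite scalerDl scalerA.
by move=> r; apply: cvgZr_tmp; exact: cvg_id.
Qed.

Lemma Dn_scale (V W : normedModType R) (h : V -> R) (w : W) vs x : smooth h ->
  Dn (fun y => h y *: w) vs x = Dn h vs x *: w.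
Proof.
move=> sh; apply: (@Dn_linear_comp _ _ _ _ (fun r : R => r *: w) h) => //.
  by move=> k a c; rewrite scalerDl scalerA.
by move=> r; apply: cvgZr_tmp; exact: cvg_id.
Qed.

Variable U : seq tree.
Hypothesis uniqU : uniq U.

Local Notation Y := 'rV[R]_(size U).+1.

(** Trees outside [U] have index [size U] and share the one spare coordinate. *)
Definition coord_index (t : tree) : 'I_(size U).+1 := inord (index t U).

Definition crd (t : tree) (y : Y) : R := y 0 (coord_index t).

Definition basis (t : tree) : Y := delta_mx 0 (coord_index t).

Definition monomial (L : seq tree) (y : Y) : R := \prod_(c <- L) crd c y.

(** The component of [leaf] is the empty product 1, which starts the recursion for elementary
    differentials at 0. *)
Definition tree_field (y : Y) : Y := \sum_(s <- U) monomial (children s) y *: basis s.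

Lemma crd_linear t : linear (crd t).
Proof. by move=> k x y; rewrite /crd !mxE. Qed.

Lemma crd_continuous t : continuous (crd t).
Proof. by move=> y; exact: coord_continuous. Qed.

Lemma smooth_crd t : smooth (crd t).
Proof. by move=> n; apply: smoothN_linear; [exact: crd_linear|exact: crd_continuous]. Qed.

Lemma derive_crd t x v : derive (crd t) x v = crd t v.
Proof. by apply: derive_linear; [exact: crd_linear|exact: crd_continuous]. Qed.

Lemma crdZ t k y : crd t (k *: y) = k * crd t y.
Proof. by rewrite /crd mxE. Qed.

Lemma crd0 t : crd t 0 = 0.
Proof. by rewrite /crd mxE. Qed.

Lemma crd_basis s t : s \in U -> t \in U -> crd s (basis t) = (s == t)%:R.
Proof.
move=> hs ht; rewrite /crd /basis mxE eqxx /=; congr (_%:R); congr nat_of_bool.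
apply/eqP/eqP => [/(congr1 val)|->//].
by rewrite /= !inordK ?ltnS ?index_size // => e; rewrite -(nth_index leaf hs) e nth_index.
Qed.

Lemma monomial_cons c L y : monomial (c :: L) y = crd c y * monomial L y.
Proof. by rewrite /monomial big_cons. Qed.

Lemma smooth_monomial L : smooth (monomial L).
Proof.
elim: L => [|c L IH].
  rewrite (_ : monomial [::] = fun=> 1); first by move=> n; exact: smoothN_cst.
  by apply/funext => y; rewrite /monomial big_nil.
rewrite (_ : monomial _ = fun y => crd c y * monomial L y).
  by apply: smooth_mul => //; exact: smooth_crd.
by apply/funext => y; exact: monomial_cons.
Qed.

Lemma smooth_tree_field : smooth tree_field.
Proof.
move=> n; apply: smoothN_sum => s.
exact: (smooth_scale _ (smooth_monomial _) n).
Qed.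

Lemma derive_monomial L t k y : {subset L <= U} -> t \in U ->
  derive (monomial L) y (k *: basis t) =
  k * (count_mem t L)%:R * monomial (rem t L) y.
Proof.
move=> + ht; elim: L => [|c L IH] hL.
  rewrite (_ : monomial [::] = fun=> 1); first by rewrite derive_cst mulr0 mul0r.
  by apply/funext => z; rewrite /monomial big_nil.
rewrite (_ : monomial (c :: L) = fun y => crd c y * monomial L y); last first.
  by apply/funext => z; exact: monomial_cons.
rewrite derive_mul; [|exact: smooth_crd|exact: smooth_monomial].
have hc : c \in U by apply: hL; exact: mem_head.
rewrite IH; last by move=> z hz; apply: hL; rewrite inE hz orbT.
rewrite derive_crd crdZ crd_basis //=.
case: eqP => [->|_]; last by rewrite monomial_cons add0n mulr0n; ring.
have [htL|/count_memPn ->] := boolP (t \in L); last by rewrite addn0 mulr1n mulr0n; ring.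
have -> : monomial L y = crd t y * monomial (rem t L) y.
  by rewrite -monomial_cons; apply: perm_big; exact: perm_to_rem.
by rewrite natrD mulr1n; ring.
Qed.

(* Differentiating a monomial at 0 along basis vectors extracts the
   coefficient of the corresponding product of variables. *)
Lemma Dn_monomial0 (a : tree -> R) ts L : {subset L <= U} -> {subset ts <= U} ->
  {in ts, forall t, 0 < a t} ->
  exists2 k, 0 < k & Dn (monomial L) [seq a t *: basis t | t <- ts] 0 = k *+ perm_eq L ts.
Proof.
move=> + + ; elim/last_ind: ts L => [|ts t IH] L hL hts ha.
  exists 1 => //=; case: L {hL} => [|c L]; first by rewrite /monomial big_nil.
  by rewrite monomial_cons crd0 mul0r; case: (boolP (perm_eq _ _)) => // /perm_size.
have htU : t \in U by apply: hts; rewrite mem_rcons mem_head.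
have hat : 0 < a t by apply: ha; rewrite mem_rcons mem_head.
have hsub : {subset rem t L <= U} by move=> z /mem_rem; exact: hL.
have [||k k0 hk] := IH (rem t L) hsub.
- by move=> z hz; apply: hts; rewrite mem_rcons inE hz orbT.
- by move=> z hz; apply: ha; rewrite mem_rcons inE hz orbT.
rewrite map_rcons Dn_rcons.
have -> : (fun x => derive (monomial L) x (a t *: basis t)) =
    (fun x => monomial (rem t L) x *: (a t * (count_mem t L)%:R : R)).
  by apply/funext => x; rewrite derive_monomial // mulrC.
rewrite Dn_scale; last exact: smooth_monomial.
rewrite hk; have [htL|htL] := boolP (t \in L).
  exists (k * (a t * (count_mem t L)%:R)).
    by rewrite !mulr_gt0 // ltr0n -has_count has_pred1.
  have -> : perm_eq L (rcons ts t) = perm_eq (rem t L) ts.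
    by rewrite (permPl (perm_to_rem htL)) perm_sym perm_rcons perm_cons perm_sym.
  by rewrite -mulrnAl.
(* The derivative vanishes here and the lists are not permutations of each other, so any positive
   witness works. *)
exists 1 => //; rewrite (count_memPn htL) mulr0 scaler0.
case: (boolP (perm_eq _ _)) => // /perm_mem /(_ t).
by rewrite (negbTE htL) mem_rcons mem_head.
Qed.

Hypothesis canonU : {in U, forall t, canonicalb t}.
Hypothesis closedU : forall t s, t \in U -> s \in children t -> s \in U.

(** Inductively the children of t give positive multiples of their basis vectors. Differentiating
    along them at 0 kills each component whose children do not match those of t, and canonicity
    leaves only t itself. *)
Lemma elem_tree_field t : t \in U ->
  0 < crd t (elem tree_field t 0) /\
  elem tree_field t 0 = crd t (elem tree_field t 0) *: basis t.
Proof.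
set a := fun t => crd t (elem tree_field t 0).
suff h : t \in U -> exists2 k, 0 < k & elem tree_field t 0 = k *: basis t.
  move=> /[dup] ht /h [k k0 e]; rewrite e crdZ crd_basis // eqxx mulr1.
  by rewrite k0.
move: t; apply: (@tree_list_ind _ (fun ts => {subset ts <= U} ->
  {in ts, forall t, 0 < a t /\ elem tree_field t 0 = a t *: basis t})).
- move=> ts IH hts.
  have sub : {subset ts <= U} by move=> s; exact: (closedU hts).
  have {}IH := IH sub.
  have ha : {in ts, forall t, 0 < a t} by move=> s /IH [].
  have subL s : s \in U -> {subset children s <= U} by move=> hs z; exact: closedU.
  rewrite elem_Node (_ : [seq _ | s <- ts] = [seq a t *: basis t | t <- ts]); last first.
    by apply/eq_in_map => s /IH [].
  have [k k0 hk] := Dn_monomial0 sub sub ha.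
  exists k => //; rewrite Dn_sum; last first.
    by move=> s; apply: smooth_scale; exact: smooth_monomial.
  rewrite (bigD1_seq (Node ts)) //= Dn_scale; last exact: smooth_monomial.
  rewrite hk perm_refl mulr1n big_seq_cond big1 ?addr0 // => s /andP[hs ne].
  rewrite Dn_scale; last exact: smooth_monomial.
  have [j _ ->] := Dn_monomial0 (subL s hs) sub ha.
  case: (boolP (perm_eq _ _)) => [hp|_]; last by rewrite mulr0n scale0r.
  case/eqP: ne; apply: canonical_children_inj => //; exact: canonU.
- by [].
- move=> t ts IHt IHts hsub s; rewrite inE => /orP[/eqP ->|hs].
    have htU : t \in U by apply: hsub; exact: mem_head.
    have [k k0 e] := IHt htU.
    by rewrite /a e crdZ crd_basis // eqxx mulr1.
  by apply: IHts => // z hz; apply: hsub; rewrite inE hz orbT.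
Qed.

(** * The quadratic test function *)

Variables u0 v0 : tree.

Definition coord_product (y : Y) : R := crd u0 y * crd v0 y.

Lemma derive_coord_product x v :
  derive coord_product x v = crd u0 x * crd v0 v + crd v0 x * crd u0 v.
Proof. by rewrite derive_mul ?derive_crd //; exact: smooth_crd. Qed.

Lemma Dn2_coord_product x u v :
  Dn coord_product [:: u; v] x = crd u0 u * crd v0 v + crd v0 u * crd u0 v.
Proof.
rewrite /= (_ : (fun x => derive coord_product x v) =
  (fun y : Y => crd v0 v * crd u0 y + crd u0 v * crd v0 y : R)); last first.
  by apply/funext => y; rewrite derive_coord_product /GRing.scale /=; ring.
rewrite derive_linear.
- by rewrite /GRing.scale /=; ring.
- by move=> k a c; rewrite !crd_linear /GRing.scale /=; ring.
- have h (r : R) t : smooth (fun y => r * crd t y).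
    by apply: smooth_mul; [move=> n; exact: smoothN_cst|exact: smooth_crd].
  by apply: (@smoothN_continuous R 0); apply: smoothN_add; exact: h.
Qed.

Lemma quadratic_coord_product : quadratic coord_product.
Proof.
split; first by apply: smooth_mul; exact: smooth_crd.
move=> x u v w; rewrite -[Dn _ _]/(fun x => derive (Dn coord_product [:: v; w]) x u).
rewrite (_ : Dn _ _ = fun=> crd u0 v * crd v0 w + crd v0 v * crd u0 w); first exact: derive_cst.
by apply/funext => y; exact: Dn2_coord_product.
Qed.

End Monomial.

(** * Extraction of one coefficient and the equivalence *)

Lemma big_select2 (R : realType) (U : seq tree) (P : rel tree)
    (X : tree -> tree -> R) a d : uniq U -> a \in U -> d \in U -> P d a ->
  \sum_(v <- U) \sum_(u <- U | P u v) X u v * ((a == v)%:R * (d == u)%:R) = X d a.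
Proof.
move=> uU ha hd hP; rewrite (bigD1_seq a) //= [X in _ + X]big1 ?addr0; last first.
  move=> v; rewrite eq_sym => /negbTE ->; apply: big1 => u _.
  by rewrite mul0r mulr0.
rewrite big_mkcond (bigD1_seq d) //= big1 ?addr0 ?hP ?eqxx ?mulr1 // => u.
by rewrite eq_sym => /negbTE ->; rewrite mulr0 mulr0 if_same.
Qed.

Theorem theorem2p16 (R : realType) (b : tree -> R) :
  quadratic_functionally_equivariant b <->
  (forall u v : tree, canonical_tree u -> canonical_tree v ->
     b (bprod u v) + b (bprod v u) = 0).
Proof.
split; last exact: antisymmetric_equivariant.
move=> hb u0 v0 hu0 hv0.
(* This n is the order of both Butcher products of u0 and v0, and each factor has order below n. *)
pose n := (tree_order u0 + tree_order v0)%N; pose U := trees_below n.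
have uU : uniq U := trees_below_uniq n.
have u0U : u0 \in U by rewrite mem_trees_below [canonicalb _]hu0 /n; have := tree_order_gt0 v0; lia.
have v0U : v0 \in U by rewrite mem_trees_below [canonicalb _]hv0 /n; have := tree_order_gt0 u0; lia.
have canU : {in U, forall t, canonicalb t} by move=> t; rewrite mem_trees_below => /andP[].
have clU t s : t \in U -> s \in children t -> s \in U.
  rewrite !mem_trees_below => /andP[ht hn] hs.
  by rewrite (canonical_child ht hs) (ltn_trans (order_child hs) hn).
pose f := @tree_field R U; pose F := @coord_product R U u0 v0.
have qF : quadratic F := quadratic_coord_product _ _ _ _.
have sf : smooth f := @smooth_tree_field R U.
have := hb 'rV[R]_(size U).+1 R F qF f sf n.
move=> /(related_bseriesP b n qF sf) /(_ 0).
pose a t := crd t (elem f t 0).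
have ha t : t \in U -> 0 < a t /\ elem f t 0 = a t *: basis R U t.
  exact: elem_tree_field.
pose X u v := b (bprod u v) / ((sigma u)%:R * (sigma v)%:R) * (a u * a v).
(* The Hessian of y_u0 y_v0 has two terms, selecting (v, u) = (u0, v0) and (v0, u0). If u0 = v0 the
   same pair is selected twice, as the sum of the two b-values requires. *)
rewrite (_ : \sum_(v <- _) _ =
  \sum_(v <- U) \sum_(u <- U | (tree_order u + tree_order v == n)%N)
     X u v * ((u0 == v)%:R * (v0 == u)%:R) +
  \sum_(v <- U) \sum_(u <- U | (tree_order u + tree_order v == n)%N)
     X u v * ((v0 == v)%:R * (u0 == u)%:R)); last first.
  rewrite -big_split /= big_seq [RHS]big_seq; apply: eq_bigr => v hv.
  rewrite -big_split /= big_seq_cond [RHS]big_seq_cond; apply: eq_bigr => u /andP[hu _].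
  rewrite (ha v hv).2 (ha u hu).2 /hessian Dn2_coord_product !crdZ !crd_basis //.
  by rewrite /X /GRing.scale /=; ring.
have P1 : (tree_order v0 + tree_order u0 == n)%N by rewrite addnC.
have P2 : (tree_order u0 + tree_order v0 == n)%N by exact: eqxx.
rewrite (big_select2 X uU u0U v0U P1) (big_select2 X uU v0U u0U P2).
have -> : X v0 u0 + X u0 v0 = (b (bprod u0 v0) + b (bprod v0 u0)) *
   ((a u0 * a v0) / ((sigma u0)%:R * (sigma v0)%:R)).
  by rewrite /X [(sigma v0)%:R * _]mulrC [a v0 * _]mulrC; ring.
have [a1 _] := ha _ u0U; have [a2 _] := ha _ v0U.
move=> /eqP; rewrite mulf_eq0 => /orP[/eqP//|/eqP h].
(* The cofactor is positive, so the vanishing product forces the sum of the two b-values to be 0. *)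
suff : (a u0 * a v0) / ((sigma u0)%:R * (sigma v0)%:R) > 0 by rewrite h ltxx.
by rewrite divr_gt0 // mulr_gt0 // ltr0n sigma_gt0.
Qed.
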